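(* Let $T>0$, let $B=\{B_t\}_{t\in[0,T]}$ be a fractional Brownian motion with Hurst parameter $H\in(0,1)$, and let $M_t:=\max_{0\le s\le t}B_s$ for $t\in[0,T]$. Let $\{\pi_n\}$ be any sequence of partitions $\pi_n=\{0=t^n_0<t^n_1<\dots<t^n_{k(n)}=T\}$ of $[0,T]$ such that $\Vert\pi_n\Vert\to 0$ as $n\to\infty$. Then the representation $$M_T=B_0+\int_0^T\mathbf{1}_{\{B_t=M_t\}}\,dB_t$$ does not hold, where the integral on the right-hand side is understood as the almost sure limit of Riemann--Stieltjes sums over the partitions $\pi_n$, $$\int_0^T\mathbf{1}_{\{B_t=M_t\}}\,dB_t:=\lim_{n\to\infty}\sum_{i=1}^{k(n)}\mathbf{1}_{\{B_{t^n_{i-1}}=M_{t^n_{i-1}}\}}\bigl(B_{t^n_i}-B_{t^n_{i-1}}\bigr).$$ That is, it is not the case that, with this definition of the integral, the displayed identity for $M_T$ holds almost surely.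
   Context: A fractional Brownian motion with Hurst index $H\in(0,1)$ is a continuous centered Gaussian process $B$ on a probability space $(\Omega,\mathcal{F},\mathbb{P})$ with $B_0=0$ and covariance $\mathbb{E}(B_sB_t)=\frac12\left(t^{2H}+s^{2H}-|t-s|^{2H}\right)$. Partitions are finite sets of nonrandom points, and $\Vert\pi_n\Vert:=\max_{1\le i\le k(n)}(t^n_i-t^n_{i-1})$ is the mesh. *)

(* Defs.v *)
From HB Require Import structures.
From mathcomp Require Import all_boot all_order all_algebra.
From mathcomp Require Import all_classical all_reals all_analysis.

Set Implicit Arguments.
Unset Strict Implicit.
Unset Printing Implicit Defensive.

Import Order.TTheory GRing.Theory Num.Theory.
Import numFieldNormedType.Exports.

Local Open Scope classical_set_scope.
Local Open Scope ring_scope.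

(* [normal_prob m s] has standard deviation [s]; it is a junk law at [s = 0],
   so the degenerate Gaussian laws are given by Dirac masses.  Laws are only
   compared on measurable sets, off which measures are unconstrained. *)
Definition gaussian_law (d : measure_display) (Omega : measurableType d)
    (R : realType) (P : probability Omega R) (X : Omega -> R) : Prop :=
  exists m s : R, 0 <= s /\
    forall A : set (measurableTypeR R), measurable A ->
      P (X @^-1` A) = if s == 0 then dirac m A else normal_prob m s A.

(* A process on [0, T] is a family indexed by all of [R], of which only the
   restriction to [0, T] is ever considered. *)
Definition gaussian_process (d : measure_display) (Omega : measurableType d)
    (R : realType) (P : probability Omega R) (T : R)
    (B : R -> {RV P >-> R}) : Prop :=
  forall (n : nat) (t a : 'I_n -> R),
    (forall i, t i \in `[0, T]) ->
    gaussian_law P (fun w => \sum_(i < n) a i * B (t i) w).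

(* Sample path properties are required almost surely only, which covers the
   case where they hold for every sample point. *)
Record fractional_brownian_motion (d : measure_display)
    (Omega : measurableType d) (R : realType) (P : probability Omega R)
    (T H : R) (B : R -> {RV P >-> R}) : Prop := FractionalBrownianMotion {
  fbm_continuous :
    {ae P, forall w, {within `[0, T], continuous (fun t : R => B t w)}};
  fbm_start : {ae P, forall w, B 0 w = 0};
  fbm_gaussian : gaussian_process T B;
  fbm_centered : forall t : R, t \in `[0, T] -> ('E_P[B t] = 0)%E;
  fbm_covariance : forall s t : R, s \in `[0, T] -> t \in `[0, T] ->
    ('E_P[(fun w => B s w * B t w)%R] =
     (2^-1 * (t `^ (2 * H) + s `^ (2 * H) - `|t - s| `^ (2 * H)))%R%:E)%E
}.

(* The supremum is a maximum on every continuous path. *)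
Definition running_max (R : realType) (Omega : Type) (X : R -> Omega -> R)
    (t : R) (w : Omega) : R :=
  sup [set X s w | s in `[0, t]].

(* As for [itv_partition a b p], the list [p] omits the first point [a]: the
   points t_0, ..., t_k are those of [a :: p]. *)
Definition mesh (R : realType) (a : R) (p : seq R) : R :=
  \big[Num.max/0]_(i < size p) ((a :: p)`_i.+1 - (a :: p)`_i).

Definition riemann_stieltjes_sum (R : realType) (a : R) (p : seq R)
    (f g : R -> R) : R :=
  \sum_(i < size p) f (a :: p)`_i * (g (a :: p)`_i.+1 - g (a :: p)`_i).

(* [I] is determined by [pi_], [f] and [g] up to almost sure equality. *)
Definition is_pathwise_integral (d : measure_display)
    (Omega : measurableType d) (R : realType) (P : probability Omega R)
    (a : R) (pi_ : nat -> seq R) (f g : R -> Omega -> R) (I : Omega -> R)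
    : Prop :=
  {ae P, forall w,
    (fun n => riemann_stieltjes_sum a (pi_ n) (f ^~ w) (g ^~ w)) @ \oo --> I w}.

(* Main.v *)
(* For fixed t > 0 the normalised backward increments
   Z_k = (B_t - B_{t - u_k}) / u_k^H, with u_k = t / 2^k, are standard Gaussians
   whose correlations tend to 0, because H < 1.  If B_t = M_t then all Z_k are
   nonnegative; on an event of positive probability the sum of n of them would
   then be of order n, whereas its L^2 norm is o(n).  Hence B_t <> M_t almost
   surely at every positive partition point, the Riemann-Stieltjes sums reduce to
   their first term B_{t_1} - B_0, which tends to 0, and the representation would
   give M_T = 0, hence B_T <= 0, almost surely.  This is impossible for a centered
   variable of positive variance. *)

Require Import Defs.
From HB Require Import structures.
From mathcomp Require Import all_boot all_order all_algebra.
From mathcomp Require Import all_classical all_reals all_analysis.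
From mathcomp Require Import measurable_realfun ring lra.

Set Implicit Arguments.
Unset Strict Implicit.
Unset Printing Implicit Defensive.

Import Order.TTheory GRing.Theory Num.Theory.
Import numFieldNormedType.Exports.

Local Open Scope classical_set_scope.
Local Open Scope ring_scope.

(** * Gaussian laws: second moments and small balls *)

(** The Radon-Nikodym derivative agrees almost everywhere with the explicit density, both having the
    same integral over every measurable set. *)
Lemma ge0_integral_normal_prob (R : realType) (m s : R) (f : R -> \bar R) :
  measurable_fun setT f -> (forall x, (0 <= f x)%E) ->
  (\int[normal_prob m s]_x f x =
   \int[lebesgue_measure]_x (f x * (normal_pdf m s x)%:E))%E.
Proof.
move=> mf f0.
have dom := normal_prob_dominates m s.
rewrite -(Radon_Nikodym_SigmaFinite.change_of_variables dom)//.
have mpdf : measurable_fun setT (fun x : measurableTypeR R => (normal_pdf m s x)%:E).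
  by apply/measurable_EFinP; exact: measurable_normal_pdf.
have mrn : measurable_fun setT
    (Radon_Nikodym_SigmaFinite.f (normal_prob m s) lebesgue_measure).
  exact: (measurable_int _ (Radon_Nikodym_SigmaFinite.f_integrable dom)).
apply: ae_eq_integral => //; [exact: emeasurable_funM|exact: emeasurable_funM|].
apply: ae_eqe_mul2l; apply: integral_ae_eq => //.
- exact: Radon_Nikodym_SigmaFinite.f_integrable.
- by move=> E _ mE; rewrite -Radon_Nikodym_SigmaFinite.f_integral.
Qed.

(* With [y = (x - m)^2 / (4 s^2)], the bound [y <= expR y] dominates
   [(x - m)^2] times the density at scale [s] by [8 s^2] times the density at
   scale [2 s]. *)
Lemma normal_prob_second_moment (R : realType) (m s : R) : 0 < s ->
  (\int[normal_prob m s]_x ((x - m) ^+ 2)%:E <= (8 * s ^+ 2)%:E)%E.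
Proof.
move=> s0; rewrite ge0_integral_normal_prob; last first.
- by move=> x; rewrite lee_fin sqr_ge0.
- apply/measurable_EFinP; apply: measurable_funX.
  exact: measurable_funB.
have s20 : 0 < 2 * s by rewrite mulr_gt0.
have -> : (8 * s ^+ 2)%:E = (\int[lebesgue_measure]_x
   ((8 * s ^+ 2)%:E * (normal_pdf m (2 * s) x)%:E))%E.
  rewrite ge0_integralZl//; first by rewrite integral_normal_pdf mule1.
  - by apply/measurable_EFinP; exact: measurable_normal_pdf.
  - by move=> x _; rewrite lee_fin normal_pdf_ge0.
  - by rewrite lee_fin mulr_ge0// sqr_ge0.
have sp : normal_peak s = 2 * normal_peak (2 * s).
  rewrite /normal_peak.
  rewrite (_ : (2 * s) ^+ 2 * pi *+ 2 = 2 ^+ 2 * (s ^+ 2 * pi *+ 2)); last by ring.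
  by rewrite sqrtrM ?sqr_ge0// sqrtr_sqr ger0_norm// invfM mulrA divff// mul1r.
apply: ge0_le_integral => //.
- by move=> x _; rewrite mule_ge0 ?lee_fin ?sqr_ge0 ?normal_pdf_ge0.
- apply/measurable_EFinP; apply: measurable_funM; last exact: measurable_normal_pdf.
  by apply: measurable_funX; exact: measurable_funB.
- apply/measurable_EFinP; apply: measurable_funM => //.
  exact: measurable_normal_pdf.
- move=> x _; rewrite -!EFinM lee_fin !normal_pdfE ?gt_eqF// sp.
  have pk := normal_peak_ge0 (2 * s).
  rewrite (_ : 8 * s ^+ 2 * _ = 2 * normal_peak (2 * s) *
    (4 * s ^+ 2 * normal_fun m (2 * s) x)); last by ring.
  rewrite mulrCA ler_wpM2l ?mulr_ge0// -ler_pdivrMl; last first.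
    by rewrite mulr_gt0// exprn_gt0.
  set y := (x - m) ^+ 2 / (4 * s ^+ 2).
  have y0 : 0 <= y by rewrite divr_ge0 ?sqr_ge0// mulr_ge0// sqr_ge0.
  (* In terms of [y] the claim becomes y exp(-2y) <= exp(-y/2), and y exp(-2y) <= exp(-y)
     suffices. *)
  have -> : normal_fun m s x = expR (- (2 * y)).
    by congr expR; rewrite /y; field; rewrite gt_eqF.
  have -> : normal_fun m (2 * s) x = expR (- (y / 2)).
    by congr expR; rewrite /y; field; rewrite gt_eqF.
  rewrite mulrA (mulrC _^-1) -/y.
  have yE : y <= expR y by apply: le_trans (expR_ge1Dx y); rewrite lerDr.
  rewrite (le_trans (ler_wpM2r (expR_ge0 _) yE))// -expRD ler_expR; lra.
Qed.

(** The parameters [m] and [s] need not be identified: the second moment about [m] is 1 + m^2, and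
    for s > 0 it is at most 8 s^2. Hence s^2 >= 1/8, which keeps the density below 2. *)
Lemma gaussian_small_ball d (Omega : measurableType d) (R : realType)
    (P : probability Omega R) (X : {RV P >-> R}) (e : R) :
  (X : Omega -> R) \in Lfun P 2%:E ->
  gaussian_law P X -> ('E_P[X] = 0)%E -> ('E_P[fun w => (X w * X w)%R] = 1)%E ->
  0 <= e -> (P (X @^-1` `[0%R, e]) <= (2 * e)%:E)%E.
Proof.
move=> X2 [m [s [s0 law]]] EX EXX e0.
have X1 := Lfun_subset12 (fin_num_measure P _ measurableT) X2.
have Xm : ('E_P[fun w => ((X w - m) ^+ 2)%R] = (1 + m ^+ 2)%:E)%E.
  have -> : (fun w => (X w - m) ^+ 2) =
    ((fun w => X w * X w) \+ (- (2 * m) \o* X)) \+ cst (m ^+ 2).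
    by apply/funext => w /=; ring.
  have L1 : (fun w => X w * X w) \in Lfun P 1%E by exact: Lfun2_mul_Lfun1.
  have L2 : (- (2 * m) \o* X) \in Lfun P 1%E by exact: Lfun_scale.
  have L3 : cst (m ^+ 2) \in Lfun P 1%E by exact: Lfun_cst.
  rewrite expectationD ?rpredD// expectationD// expectation_cst expectationZl//.
  by rewrite EXX EX mule0 adde0.
(* [normal_prob] lives on [measurableTypeR R], whose display differs from that
   of [R] although the measurable sets are the same. *)
have mX : measurable_fun setT (X : Omega -> measurableTypeR R).
  by move=> mT A mA; exact: (measurable_funPT X mT A mA).
pose XB : {mfun Omega >-> measurableTypeR R} :=
  @mfun_Sub _ _ Omega (measurableTypeR R) X (mem_set mX).
pose sq : measurableTypeR R -> \bar R := fun x => ((x - m) ^+ 2)%:E.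
have msq : measurable_fun setT sq.
  apply/measurable_EFinP; apply: measurable_funX; exact: measurable_funB.
have : ((1 + m ^+ 2)%:E = \int[distribution P XB]_x sq x)%E.
  rewrite -Xm unlock ge0_integral_distribution//.
  by move=> x; rewrite lee_fin sqr_ge0.
have eq_law (Q : {measure set (measurableTypeR R) -> \bar R}) :
    (forall A, measurable A -> P (X @^-1` A) = Q A) ->
    (\int[distribution P XB]_x sq x = \int[Q]_x sq x)%E.
  by move=> PQ; apply: eq_measure_integral => A mA _; exact: PQ.
(* A Dirac mass at [m] has second moment 0 about [m], not 1 + m^2, so s = 0 is impossible. *)
move: s0; rewrite le_eqVlt => /predU1P[s0|s0].
  subst s.
  rewrite (eq_law (@dirac _ (measurableTypeR R) m R)); last first.
    by move=> A mA; rewrite law// eqxx.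
  rewrite integral_dirac// diracT mul1e /sq subrr expr0n/= => -[] /eqP.
  by rewrite gt_eqF// ltr_pwDl// sqr_ge0.
rewrite (eq_law (normal_prob m s)); last first.
  by move=> A mA; rewrite law// gt_eqF.
move=> Em.
have := normal_prob_second_moment m s0.
rewrite -Em lee_fin => s8.
have ps2 : normal_peak s <= 2.
  rewrite /normal_peak -[leRHS]invrK lef_pV2 ?posrE ?invr_gt0//; last first.
    by rewrite sqrtr_gt0 mulrn_wgt0// mulr_gt0 ?pi_gt0// exprn_gt0.
  rewrite -[leLHS]ger0_norm// -sqrtr_sqr ler_wsqrtr//.
  have p2 : 2 <= pi :> R := pi_ge2 R.
  have s8' : 1 <= 8 * s ^+ 2 by rewrite (le_trans _ s8)// lerDl sqr_ge0.
  nra.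
rewrite law// gt_eqF// /normal_prob.
apply: (@le_trans _ _ (\int[lebesgue_measure]_(x in `[0%R, e]) (2%R)%:E)%E).
  apply: ge0_le_integral => //.
  - by move=> x _; rewrite lee_fin normal_pdf_ge0.
  - apply/measurable_funTS/measurable_EFinP; exact: measurable_normal_pdf.
  - by move=> x _; rewrite lee_fin (le_trans (normal_pdf_ub _ _ _)) ?gt_eqF.
rewrite integral_cst//= lebesgue_measure_itv/= lte_fin.
case: ltP => _; first by rewrite oppr0 adde0.
by rewrite mule0 lee_fin mulr_ge0.
Qed.

(** * Nearly orthogonal nonnegative variables *)

(** Bounds the second moment of a sum, with [c] the matrix of mixed moments: the diagonal
    contributes at most n, the other entries at most n^2 e. *)
Lemma sum_cross_le (R : realType) (n : nat) (c : nat -> nat -> R) (e : R) :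
  (forall i, c i i <= 1) -> (forall i j, i != j -> c i j <= e) -> 0 <= e ->
  \sum_(i < n) \sum_(j < n) c i j <= n%:R + n%:R ^+ 2 * e.
Proof.
move=> ci cij e0.
apply: (@le_trans _ _ (\sum_(i < n) (1 + n%:R * e))).
  apply: ler_sum => i _; rewrite (bigD1 i)//= lerD//.
  apply: (@le_trans _ _ (\sum_(j < n | j != i) e)).
    by apply: ler_sum => j ji; rewrite cij// eq_sym.
  rewrite sumr_const -[leLHS]mulr_natl ler_wpM2r// ler_nat.
  by rewrite (leq_trans (max_card _))// card_ord.
by rewrite sumr_const card_ord -[leLHS]mulr_natl mulrDr mulr1 mulrA expr2.
Qed.

(* On [A] the sum [S] of [n] of the variables is at least
   [e * #{k | e < Z k}], while [E S^2 = o(n^2)] along a sparse subsequence. *)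
Lemma almost_orthogonal_nonneg_null d (Omega : measurableType d)
    (R : realType) (P : probability Omega R) (Z : nat -> {RV P >-> R})
    (A : set Omega) :
  measurable A -> (forall k w, A w -> 0 <= Z k w) ->
  (forall k, (Z k : Omega -> R) \in Lfun P 2%:E) ->
  (forall k, ('E_P[fun w => (Z k w * Z k w)%R] = 1)%E) ->
  (forall e : R, 0 < e -> exists m, forall i j, (i + m <= j)%N ->
     ('E_P[fun w => (Z i w * Z j w)%R] <= e%:E)%E) ->
  (forall k (e : R), 0 <= e -> (P (Z k @^-1` `[0%R, e]) <= (2 * e)%:E)%E) ->
  P A = 0.
Proof.
move=> mA AZ Z2 Zvar Zcov Zball; apply/eqP; apply: contraT => PA0.
have PAfin : P A \is a fin_num by exact: fin_num_measure.
set p := fine (P A).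
have p0 : 0 < p by rewrite fine_gt0// lt0e PA0 measure_ge0 -ge0_fin_numE.
have PAE : P A = p%:E by rewrite fineK.
(* With p = 8 e, the final comparison sets 8 N e^2 against 2 N e^2 from the small balls, l / 2 = N
   e^2, and a second-moment term. The latter is at most N e^2 because eps = 2 e^4 and N eps > 1. *)
pose e := p / 8.
pose eps := 2 * e ^+ 4.
have e0 : 0 < e by rewrite divr_gt0.
have eps0 : 0 < eps by rewrite mulr_gt0// exprn_gt0.
have [m mcov] := Zcov _ eps0.
(* Distinct multiples of [m.+1] differ by more than [m], so all off-diagonal mixed moments of [W]
   are at most [eps]. *)
pose W k := Z (k * m.+1)%N.
have Wcov i j : i != j -> ('E_P[fun w => (W i w * W j w)%R] <= eps%:E)%E.
  rewrite neq_ltn => /orP[ij|ij]; last first.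
    rewrite (_ : (fun w => _) = (fun w => W j w * W i w)); last first.
      by apply/funext => w; rewrite mulrC.
    apply: mcov; rewrite (@leq_trans (j.+1 * m.+1))// ?leq_mul2r ?ij ?orbT//.
    by rewrite mulSn addnC leq_add2r.
  apply: mcov; rewrite (@leq_trans (i.+1 * m.+1))// ?leq_mul2r ?ij ?orbT//.
    by rewrite mulSn addnC leq_add2r.
have [n n1] : exists n, eps^-1 < n.+1%:R.
  by exists (Num.truncn eps^-1); exact: truncnS_gt.
pose N : R := n.+1%:R.
have N0 : 0 < N by rewrite ltr0n.
pose l := 2 * (N * e ^+ 2).
have l0 : 0 < l by rewrite !mulr_gt0// exprn_gt0.
pose S w := \sum_(k < n.+1) W k w.
have L1 i j : (fun w => W i w * W j w) \in Lfun P 1%E.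
  exact: (Lfun2_mul_Lfun1 (Z2 _) (Z2 _)).
have ES2 : (\int[P]_w ((S w) ^+ 2)%:E <= (N + N ^+ 2 * eps)%:E)%E.
  pose c i j := fine ('E_P[fun w => (W i w * W j w)%R]).
  have cE i j : ('E_P[fun w => (W i w * W j w)%R] = (c i j)%:E)%E.
    by rewrite fineK// expectation_fin_num.
  rewrite (_ : (\int[P]_w _)%E = (\sum_(i < n.+1) \sum_(j < n.+1) c i j)%:E).
    rewrite lee_fin; apply: sum_cross_le (ltW eps0) => //.
      by move=> i; rewrite -lee_fin -cE Zvar.
    by move=> i j ij; rewrite -lee_fin -cE Wcov.
  transitivity (\int[P]_w (\sum_(i < n.+1) \sum_(j < n.+1) (W i w * W j w)%:E))%E.
    apply: eq_integral => w _; rewrite expr2 mulr_suml -sumEFin.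
    by apply: eq_bigr => i _; rewrite mulr_sumr -sumEFin.
  have intW i j : P.-integrable setT (fun w => (W i w * W j w)%:E).
    exact/Lfun1_integrable.
  rewrite integral_sum//; last by move=> i; exact: integrable_sum.
  rewrite -sumEFin; apply: eq_bigr => i _.
  rewrite integral_sum// -sumEFin; apply: eq_bigr => j _.
  by rewrite -cE unlock.
have mS : measurable_fun setT S.
  by apply: measurable_sum => k; apply: measurable_funPT.
(* On [A] each [W k] lies in [0, e] or exceeds e, so N e <= e #{k | W k <= e} + S. The bound S <=
   l/2 + S^2/(2l) then replaces S by its square, whose mean is controlled. *)
have pointwise w : N * e * (\1_A w) <=
    e * (\sum_(k < n.+1) \1_(W k @^-1` `[0%R, e]) w) + (l / 2 + S w ^+ 2 / (2 * l)).
  have AG : S w <= l / 2 + S w ^+ 2 / (2 * l).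
    rewrite -subr_ge0.
    have -> : l / 2 + S w ^+ 2 / (2 * l) - S w = (l - S w) ^+ 2 / (2 * l).
      by field; rewrite gt_eqF.
    by rewrite divr_ge0 ?sqr_ge0// mulr_ge0// ltW.
  rewrite !indicE; have [wA|wA] := boolP (w \in A); last first.
    rewrite mulr0 addr_ge0//.
      rewrite mulr_ge0 ?(ltW e0)// sumr_ge0// => k _; exact: indic_ge0.
    by rewrite addr_ge0// divr_ge0 ?sqr_ge0 ?mulr_ge0 ?ltW.
  apply: (le_trans _ (lerD (lexx _) AG)).
  rewrite mulr_sumr -big_split/= mulr1 /N mulr_natl -[in leLHS](card_ord n.+1).
  rewrite -sumr_const; apply: ler_sum => k _.
  have Wk0 : 0 <= W k w by apply: AZ; exact/set_mem.
  rewrite indicE; case: (boolP (w \in _)) => [_|]; first by rewrite mulr1 lerDl.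
  rewrite notin_setE/= in_itv/= Wk0/= => /negP; rewrite -ltNge mulr0 add0r; exact: ltW.
(* Expectation of [pointwise], with the small-ball hypothesis for the indicators and [ES2] for the
   square. *)
have : ((N * e * p)%:E <= (e * (\sum_(k < n.+1) (2 * e)) +
    (l / 2 + (2 * l)^-1 * (N + N ^+ 2 * eps)))%:E)%E.
  pose U w := e * (\sum_(k < n.+1) \1_(W k @^-1` `[0%R, e]) w).
  have mWe k : measurable (W k @^-1` `[0%R, e]).
    by rewrite -[X in measurable X]setTI; apply: measurable_funPT.
  have sum0 w : 0 <= \sum_(k < n.+1) \1_(W k @^-1` `[0%R, e]) w :> R.
    by apply: sumr_ge0.
  have msum : measurable_fun setT
      (fun w => \sum_(k < n.+1) \1_(W k @^-1` `[0%R, e]) w : R).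
    by apply: measurable_sum => k; exact: measurable_indic.
  have U0 w : 0 <= U w by rewrite mulr_ge0// ltW.
  have mU : measurable_fun setT U by exact: measurable_funM.
  have UE : (\int[P]_w (U w)%:E <= (e * (\sum_(k < n.+1) (2 * e)))%:E)%E.
    under eq_integral do rewrite EFinM.
    rewrite ge0_integralZl//; last 3 first.
    - exact/measurable_EFinP.
    - by move=> w _; rewrite lee_fin.
    - by rewrite lee_fin ltW.
    rewrite [leRHS]EFinM; apply: lee_wpmul2l; first by rewrite lee_fin ltW.
    rewrite -sumEFin.
    under eq_integral do rewrite -sumEFin.
    rewrite ge0_integral_sum//; last first.
      by move=> k; apply/measurable_EFinP; exact: measurable_indic.
    by apply: lee_sum => k _; rewrite integral_indic// setIT Zball// ltW.
  have VE : (\int[P]_w ((2 * l)^-1 * S w ^+ 2)%:E <=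
      ((2 * l)^-1 * (N + N ^+ 2 * eps))%:E)%E.
    under eq_integral do rewrite EFinM.
    rewrite ge0_integralZl//; last 3 first.
    - by apply/measurable_EFinP; exact: measurable_funX.
    - by move=> w _; rewrite lee_fin sqr_ge0.
    - by rewrite lee_fin invr_ge0 mulr_ge0// ltW.
    rewrite [leRHS]EFinM; apply: lee_wpmul2l => //.
    by rewrite lee_fin invr_ge0 mulr_ge0// ltW.
  have -> : ((N * e * p)%:E = \int[P]_w (N * e * \1_A w)%:E)%E.
    under eq_integral do rewrite EFinM.
    rewrite ge0_integralZl//; last 2 first.
    - exact/measurable_EFinP.
    - by rewrite lee_fin mulr_ge0 ?ltW.
    by rewrite integral_indic// setIT [X in (_ * X)%E]PAE.
  have mV : measurable_fun setT (fun w => ((2 * l)^-1 * S w ^+ 2)%:E).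
    by apply/measurable_EFinP; apply: measurable_funM => //; exact: measurable_funX.
  have V0 w : (0 <= ((2 * l)^-1 * S w ^+ 2)%:E)%E.
    by rewrite lee_fin mulr_ge0 ?sqr_ge0// invr_ge0 mulr_ge0 ?ltW.
  have l20 : (0 <= (l / 2)%:E)%E by rewrite lee_fin divr_ge0 ?ltW.
  apply: (@le_trans _ _ (\int[P]_w ((U w)%:E +
      ((l / 2)%:E + ((2 * l)^-1 * S w ^+ 2)%:E))%E)%E).
    apply: ge0_le_integral => //.
    - by move=> w _; rewrite lee_fin !mulr_ge0// ?ltW.
    - by apply/measurable_EFinP; apply: measurable_funM.
    - apply: emeasurable_funD => //; last exact: emeasurable_funD.
      exact/measurable_EFinP.
    - by move=> w _; rewrite -!EFinD lee_fin [(2 * l)^-1 * _]mulrC pointwise.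
  rewrite ge0_integralD//; last 4 first.
  - by move=> w _; rewrite lee_fin.
  - exact/measurable_EFinP.
  - by move=> w _; rewrite adde_ge0.
  - exact: emeasurable_funD.
  rewrite ge0_integralD// integral_cst// [X in ((l / 2)%:E * X)%E]probability_setT mule1.
  by rewrite EFinD leeD// EFinD leeD2l.
rewrite lee_fin sumr_const card_ord -[2 * e *+ _]mulr_natl.
have ineps : N * eps > 1 by rewrite -ltr_pdivrMr// mul1r.
rewrite leNgt => /negP[].
have -> : l / 2 + (2 * l)^-1 * (N + N ^+ 2 * eps) =
    N * e ^+ 2 + (1 + N * eps) / (4 * e ^+ 2).
  by rewrite /l; field; rewrite !gt_eqF.
have -> : p = 8 * e by rewrite /e mulrC divfK.
have : (1 + N * eps) / (4 * e ^+ 2) <= N * e ^+ 2.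
  have -> : N * e ^+ 2 = (2 * (N * eps)) / (4 * e ^+ 2).
    by rewrite /eps; field; rewrite gt_eqF.
  rewrite ler_wpM2r ?invr_ge0 ?mulr_ge0 ?sqr_ge0//; lra.
have : 0 < N * e ^+ 2 by rewrite mulr_gt0// exprn_gt0.
have -> : N * e * (8 * e) = 8 * (N * e ^+ 2) by ring.
have -> : e * (N * (2 * e)) = 2 * (N * e ^+ 2) by ring.
lra.
Qed.

(** * Decorrelation of increments at separated scales *)

Lemma powR_mul2 (R : realType) (x r : R) : 0 < x ->
  x `^ (2 * r) = x `^ r * x `^ r.
Proof.
move=> x0; rewrite (_ : 2 * r = r + r); last by ring.
by rewrite powRD// (gt_eqF x0) implybT.
Qed.

(** With v = q u, dividing by u^(2H) leaves (1 + q^(2H) - (1 - q)^(2H)) / 2. This is at most q^(2H)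
    / 2 + q = q^H (q^H / 2 + q^(1 - H)), and the last factor tends to 0 with q since 0 < H < 1. *)
Lemma fbm_covariance_small (R : realType) (H e : R) : 0 < H < 1 -> 0 < e ->
  exists2 r : R, 0 < r & forall u v, 0 < u -> 0 < v < r * u ->
    2^-1 * (u `^ (2 * H) + v `^ (2 * H) - `|u - v| `^ (2 * H)) <=
    e * (u `^ H * v `^ H).
Proof.
move=> /andP[H0 H1] e0.
have cvg0 : q `^ H + q `^ (1 - H) @[q --> (0:R)^'+] --> (0 : R).
  by rewrite -[X in _ --> X]addr0; apply: cvgD; apply: powR_cvg0; rewrite ?subr_gt0.
have [r /= r0 rP] : \forall q \near (0:R)^'+, q `^ H + q `^ (1 - H) < e.
  exact: cvgr_lt cvg0 _ e0.
(* The cap at 1 forces v < u, so that |u - v| = (1 - q) u. *)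
exists (Num.min r 1); first by rewrite lt_min r0 ltr01.
move=> u v u0 /andP[v0 vr].
have [q q0 vE] : exists2 q, 0 < q & v = q * u.
  by exists (v / u); rewrite ?divr_gt0// divfK// gt_eqF.
have : q < Num.min r 1 by rewrite -(ltr_pM2r u0) -vE.
rewrite lt_min => /andP[qr q1].
have : q `^ H + q `^ (1 - H) < e.
  by apply: rP => //=; rewrite sub0r normrN gtr0_norm.
have uvE : `|u - v| = (1 - q) * u.
  by rewrite vE -[X in X - _]mul1r -mulrBl gtr0_norm// mulr_gt0// subr_gt0.
have q1' : 0 < 1 - q by rewrite subr_gt0.
rewrite uvE vE !powRM ?(ltW u0) ?(ltW q0) ?(ltW q1')//.
have qE : q = q `^ H * q `^ (1 - H).
  by rewrite -powRD ?(gt_eqF q0) ?implybT// addrC subrK powRr1// ltW.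
(* As 0 < 1 - q <= 1 and 2 H <= 2, the power is at least (1 - q)^2 = 1 - 2 q + q^2. *)
have bern : 1 - 2 * q <= (1 - q) `^ (2 * H).
  apply: (@le_trans _ _ ((1 - q) `^ 2)).
    by rewrite powR_mulrn ?(ltW q1')// sqrrB expr1n mul1r mulr_natl lerDl sqr_ge0.
  apply: ger_powR; first by rewrite q1' gerBl ltW.
  by rewrite ler_piMr// ltW.
rewrite (powR_mul2 _ u0) (powR_mul2 _ q0).
have a0 : 0 < q `^ H by exact: powR_gt0.
have c0 : 0 < u `^ H * u `^ H by rewrite mulr_gt0// powR_gt0.
have b0 : 0 < q `^ (1 - H) by exact: powR_gt0.
move: bern; rewrite {1}qE.
set a := q `^ H in a0 *; set b := q `^ (1 - H) in b0 *.
set z := (1 - q) `^ _; set c := u `^ H in c0 *.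
move=> bern abe.
rewrite (_ : 2^-1 * _ = (c * c) * (2^-1 * (1 + a * a - z))); last by ring.
rewrite (_ : e * _ = (c * c) * (e * a)); last by ring.
rewrite ler_pM2l//.
have : (a + b) * a <= e * a by rewrite ler_pM2r// ltW.
have := mulr_gt0 a0 a0.
lra.
Qed.

(** * Square integrability and running maxima *)

Lemma sqr_integrable_Lfun2 d (Omega : measurableType d) (R : realType)
    (P : probability Omega R) (X : {RV P >-> R}) :
  ('E_P[fun w => (X w * X w)%R] < +oo)%E -> (X : Omega -> R) \in Lfun P 2%:E.
Proof.
rewrite unlock => XX; rewrite inE; apply/andP; split.
  by rewrite inE/=; exact: measurable_funPT.
rewrite inE/= /finite_norm unlock/=.
apply: poweR_lty; apply: le_lt_trans XX.
under eq_integral do rewrite powR_mulrn// real_normK ?num_real// expr2.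
exact: lexx.
Qed.

(** Continuity on the compact [[0, T]] bounds the path, so [sup] is a true least upper bound and not
    its default value. *)
Lemma le_running_max (Omega : Type) (R : realType) (X : R -> Omega -> R)
    (T t s : R) (w : Omega) :
  {within `[0, T], continuous (X ^~ w)} -> 0 <= s <= t -> t <= T ->
  X s w <= running_max X t w.
Proof.
move=> cX /andP[s0 st] tT.
have T0 : 0 <= T by rewrite (le_trans s0)// (le_trans st).
have [c _ cmax] := EVT_max T0 cX.
apply: ub_le_sup; last by exists s => //=; rewrite in_itv/= s0.
exists (X c w) => _ [r /= + <-]; rewrite in_itv/= => /andP[r0 rt].
by apply: cmax; rewrite in_itv/= r0 (le_trans rt).
Qed.

(** * Almost surely, a fixed positive time does not attain the running maximum *)

Section fbm.
Context d (Omega : measurableType d) (R : realType) (P : probability Omega R)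
  (T H : R) (B : R -> {RV P >-> R}).
Hypotheses (H01 : 0 < H < 1) (BH : fractional_brownian_motion T H B).

(** Since [powR 0 0] is 1, a nonzero exponent is what makes |t - t|^(2H) vanish. *)
Let H20 : 2 * H != 0.
Proof. by move: H01 => /andP[H0 _]; rewrite mulf_neq0// gt_eqF. Qed.

Lemma fbm_Lfun2 t : t \in `[0, T] -> (B t : Omega -> R) \in Lfun P 2%:E.
Proof.
by move=> t0T; apply: sqr_integrable_Lfun2; rewrite (fbm_covariance BH)// ltry.
Qed.

Lemma fbm_increment_covariance t a b :
  t \in `[0, T] -> a \in `[0, T] -> b \in `[0, T] ->
  ('E_P[fun w => ((B t w - B a w) * (B t w - B b w))%R] =
   (2^-1 * (`|t - a| `^ (2 * H) + `|t - b| `^ (2 * H)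
            - `|a - b| `^ (2 * H)))%R%:E)%E.
Proof.
move=> tT aT bT.
have L s r : s \in `[0, T] -> r \in `[0, T] ->
    (fun w => B s w * B r w) \in Lfun P 1%E.
  by move=> sT rT; exact: (Lfun2_mul_Lfun1 (fbm_Lfun2 sT) (fbm_Lfun2 rT)).
rewrite (_ : (fun w => _) =
    (((fun w => B t w * B t w) \- (fun w => B t w * B b w)) \-
     ((fun w => B a w * B t w) \- (fun w => B a w * B b w)))); last first.
  by apply/funext => w /=; ring.
rewrite !expectationB ?rpredB ?L// !(fbm_covariance BH)//.
rewrite -!EFinB; congr EFin.
rewrite subrr normr0 powR0// (distrC b t) (distrC b a); ring.
Qed.

Lemma fbm_expectation_increment t a : t \in `[0, T] -> a \in `[0, T] ->
  ('E_P[(B t \- B a)%R] = 0)%E.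
Proof.
move=> tT aT; have L1 s : s \in `[0, T] -> (B s : Omega -> R) \in Lfun P 1%E.
  by move=> sT; exact: (Lfun_subset12 (fin_num_measure P _ measurableT) (fbm_Lfun2 sT)).
by rewrite expectationB ?L1// !(fbm_centered BH)// sube0.
Qed.

Lemma fbm_neq_running_max t : 0 < t <= T ->
  {ae P, forall w, B t w != running_max B t w}.
Proof.
move=> /andP[t0 tT].
pose u k : R := t / 2 ^+ k.
have u0 k : 0 < u k by rewrite divr_gt0// exprn_gt0.
have ut k : u k <= t.
  by rewrite ler_pdivrMr ?exprn_gt0// ler_peMr ?(ltW t0)// exprn_ege1// ler1n.
have tT' : t \in `[0, T] by rewrite in_itv/= tT ltW.
have tuT k : t - u k \in `[0, T].
  by rewrite in_itv/= subr_ge0 ut (le_trans _ tT)// gerBl ltW.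
have uH0 k : 0 < u k `^ H by exact: powR_gt0.
pose Z k : {RV P >-> R} := (u k `^ H)^-1 \o* (B t \- B (t - u k)).
have D2 k : (B t \- B (t - u k) : Omega -> R) \in Lfun P 2%:E.
  by rewrite rpredB ?lee1n//= => *; rewrite fbm_Lfun2.
have D1 k := Lfun_subset12 (fin_num_measure P _ measurableT) (D2 k).
have Z2 k : (Z k : Omega -> R) \in Lfun P 2%:E.
  by apply: (Lfun_scale _ _ (D2 k)); rewrite ler1n.
have Zcov i j : ('E_P[fun w => (Z i w * Z j w)%R] =
    ((2^-1 * (u i `^ (2 * H) + u j `^ (2 * H) - `|u i - u j| `^ (2 * H)))
     / (u i `^ H * u j `^ H))%:E)%E.
  rewrite (_ : (fun w => _) = (u i `^ H * u j `^ H)^-1 \o*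
     (fun w => (B t w - B (t - u i) w) * (B t w - B (t - u j) w))); last first.
    by apply/funext => w /=; rewrite invfM; ring.
  rewrite expectationZl; last first.
    exact: (Lfun2_mul_Lfun1 (D2 i) (D2 j)).
  rewrite fbm_increment_covariance// -EFinM mulrC; congr (_ / _)%:E.
  have -> : t - u i - (t - u j) = - (u i - u j) by ring.
  by rewrite normrN !subKr (gtr0_norm (u0 i)) (gtr0_norm (u0 j)).
have E0 k : ('E_P[Z k] = 0)%E.
  transitivity ((u k `^ H)^-1%:E * 'E_P[(B t \- B (t - u k))%R])%E.
    exact: (expectationZl _ (D1 k)).
  by rewrite fbm_expectation_increment// mule0.
have Zvar k : ('E_P[fun w => (Z k w * Z k w)%R] = 1)%E.
  rewrite Zcov subrr normr0 powR0// subr0 powR_mul2//.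
  by congr EFin; field; rewrite gt_eqF.
(* On continuous paths [A] contains the event B_t = M_t. Being measurable, it spares any proof that
   the running maximum is. *)
pose A := \bigcap_k ((Z k) @^-1` `[0, +oo[).
have mA : measurable A.
  apply: bigcap_measurable => // k _; rewrite -[X in measurable X]setTI.
  exact: measurable_funPT.
have PA : P A = 0.
  apply: (@almost_orthogonal_nonneg_null _ _ _ _ Z) => //.
  - by move=> k w /(_ k I); rewrite /= in_itv/= andbT.
  - move=> e e0; have [r r0 rP] := fbm_covariance_small H01 e0.
    (* For j >= i + m this gives u_j <= u_i / 2^m < r u_i, the required separation of scales. *)
    have [m rm] : exists m, r^-1 < 2 ^+ m.
      exists (Num.truncn r^-1).+1; apply: (lt_trans (truncnS_gt _)).
      by rewrite -natrX ltr_nat ltn_expl.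
    exists m => i j ij; rewrite Zcov lee_fin ler_pdivrMr ?mulr_gt0//.
    apply: rP => //; rewrite u0/= ltr_pdivrMr ?exprn_gt0//.
    apply: (@lt_le_trans _ _ (r * u i * (2 ^+ i * 2 ^+ m))).
      rewrite (_ : _ * _ = t * (r * 2 ^+ m)); last first.
        by rewrite /u; field; rewrite expf_neq0.
      by rewrite ltr_pMr// mulrC -ltr_pdivrMr// mul1r.
    have ru0 : 0 <= r * u i by rewrite mulr_ge0// ltW.
    by rewrite -exprD ler_wpM2l// ler_weXn2l// ler1n.
  - move=> k e e0; apply: gaussian_small_ball => //.
    (* Writes Z_k as a combination of B at the two times t and t - u_k, the form in which
       Gaussianity is assumed. *)
    pose s (i : 'I_2) := if val i == 0%N then t else t - u k.
    pose a (i : 'I_2) := (-1) ^+ i * (u k `^ H)^-1.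
    rewrite (_ : (Z k : Omega -> R) = fun w => \sum_(i < 2) a i * B (s i) w).
      by apply: (fbm_gaussian BH) => i; rewrite /s; case: ifP.
    apply/funext => w; rewrite !big_ord_recl big_ord0 /a /s/= expr0 expr1; ring.
have nA : {ae P, forall w, ~ A w}.
  by exists A; split => // w /= /contrapT.
move: (fbm_continuous BH) nA; apply: filterS2 => w cB.
apply: contra_notN => /eqP BM k _ /=.
rewrite in_itv/= andbT mulr_ge0 ?invr_ge0 ?powR_ge0// subr_ge0.
have := tuT k; rewrite in_itv/= => /andP[tu0 _].
rewrite BM; apply: le_running_max cB _ tT.
by rewrite tu0 gerBl ltW.
Qed.

End fbm.

(** * Collapse of the Riemann-Stieltjes sums and contradiction *)

Lemma itv_partition_nth_gt0_le (R : realType) (T : R) (p : seq R) (i : nat) :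
  itv_partition 0 T p -> (0 < i <= size p)%N -> 0 < (0 :: p)`_i <= T.
Proof.
move=> pT /andP[i0 ip]; have [p0 _] := pT.
case: i i0 ip => //= i _ ip.
have i2 : (i.+1 < (size p).+1)%N by [].
rewrite (allP (order_path_min lt_trans p0)) ?mem_nth//=.
by rewrite (set_nth_default T)//; exact: itv_partition_nth_le i2 pT.
Qed.

Lemma running_max0 (R : realType) (Omega : Type) (X : R -> Omega -> R)
    (w : Omega) : running_max X 0 w = X 0 w.
Proof. by rewrite /running_max set_itv1 image_set1 sup1. Qed.

(** The head of [p] is the point t_1, hence the first gap t_1 - t_0 since t_0 = 0. *)
Lemma nth1_le_mesh (R : realType) (p : seq R) :
  (0 < size p)%N -> p`_0 <= mesh 0 p.
Proof.
case: p => //= x p _; rewrite /mesh.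
by apply: le_trans (le_bigmax _ _ ord0); rewrite /= subr0.
Qed.

(** Here |X| = -X almost surely has mean 0, so X vanishes almost surely. *)
Lemma ae_le0_expectation0 d (Omega : measurableType d) (R : realType)
    (P : probability Omega R) (X : {RV P >-> R}) :
  (X : Omega -> R) \in Lfun P 1%E -> {ae P, forall w, X w <= 0} ->
  ('E_P[X] = 0)%E -> ('E_P[fun w => (X w * X w)%R] = 0)%E.
Proof.
move=> X1 Xle0 EX.
have mX : measurable_fun setT (EFin \o X).
  by apply/measurable_EFinP; exact: measurable_funPT.
have : (\int[P]_w `|(X w)%:E| = 0)%E.
  transitivity ('E_P[(-1) \o* X])%E; last by rewrite expectationZl// EX mule0.
  rewrite unlock; apply: ae_eq_integral => //.
  - exact: measurableT_comp.
  - by apply/measurable_EFinP; apply: measurable_funM => //; exact: measurable_funPT.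
  - apply: filterS Xle0 => w Xw _ /=.
    by rewrite ler0_norm// mulrN1.
move/(ae_eq_integral_abs _ measurableT mX) => X0.
rewrite unlock -(integral0 P setT); apply: ae_eq_integral => //.
- by apply/measurable_EFinP; apply: measurable_funM; exact: measurable_funPT.
- by apply: filterS X0 => w /(_ I)[Xw0] _ /=; rewrite Xw0 mulr0.
Qed.

Unset Implicit Arguments.

Theorem corollary3p1 (d : measure_display) (Omega : measurableType d)
    (R : realType) (P : probability Omega R) (T H : R)
    (B : R -> {RV P >-> R}) (pi_ : nat -> seq R) :
  0 < T -> 0 < H < 1 ->
  fractional_brownian_motion T H B ->
  (forall n, itv_partition 0 T (pi_ n)) ->
  (fun n => mesh 0 (pi_ n)) @ \oo --> (0 : R) ->
  let M := running_max B in
  ~ exists I : Omega -> R,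
      is_pathwise_integral P 0 pi_ (fun t w => (B t w == M t w)%:R) B I /\
      {ae P, forall w, M T w = B 0 w + I w}.
Proof.
move=> T0 H01 BH part mesh0 M [I [RS MI]].
have TT : T \in `[0, T] by rewrite in_itv/= lexx ltW.
have size_gt0 n : (0 < size (pi_ n))%N.
  rewrite lt0n; apply/eqP => /size0nil p0; have := part n.
  by rewrite p0 => /itv_partition_nil T0E; rewrite T0E ltxx in T0.
(* Countably many partition points leave a single null set. Index 0 is excluded because B_0 =
   M_0. *)
have neq : {ae P, forall w, forall n i, (0 < i < size (pi_ n))%N ->
    B (0 :: pi_ n)`_i w != M (0 :: pi_ n)`_i w}.
  apply: ae_foralln => n; apply: ae_foralln => i.
  have [/andP[i0 ip]|_] := boolP (0 < i < size (pi_ n))%N; last exact: aeW.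
  have ti : 0 < (0 :: pi_ n)`_i <= T.
    by apply: itv_partition_nth_gt0_le (part n) _; rewrite i0 ltnW.
  by apply: filterS (fbm_neq_running_max H01 BH ti) => w + _.
have BT_le0 : {ae P, forall w, B T w <= 0}.
  apply: filterS (filterI (filterI neq (filterI RS MI))
    (filterI (fbm_start BH) (fbm_continuous BH))).
  move=> w [[neqw [RSw MIw]] [B0 cB]].
  (* Only the term at t_0 = 0 survives, with indicator 1. It equals B at t_1, the head of
     [pi_ n]. *)
  have sumE n : riemann_stieltjes_sum 0 (pi_ n)
      (fun t => (B t w == M t w)%:R) (B ^~ w) = B (pi_ n)`_0 w.
    rewrite /riemann_stieltjes_sum; have := neqw n; have := size_gt0 n.
    case: (pi_ n) => //= x p _ neqn.
    rewrite big_ord_recl big1 ?addr0 => [|i _] /=.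
      by rewrite /M running_max0 eqxx mul1r B0 subr0.
    by rewrite add0n (negbTE (neqn i.+1 (ltn_ord i))) mul0r.
  have pos n : 0 < (pi_ n)`_0.
    by case/andP: (@itv_partition_nth_gt0_le _ _ _ 1 (part n) (size_gt0 n)).
  have t0 : (fun n => (pi_ n)`_0) @ \oo --> (0 : R).
    apply: (squeeze_cvgr _ (cvg_cst 0) mesh0); apply: nearW => n.
    by rewrite (ltW (pos n)) nth1_le_mesh.
  (* The points t_1 are positive and tend to 0, so right continuity at 0 identifies the limit of the
     sums. *)
  have [_ right_cont _] := (continuous_within_itvP _ T0).1 cB.
  have lim0 : (fun n => B (pi_ n)`_0 w) @ \oo --> B 0 w.
    by apply: (cvg_at_rightP _ _ _).1 right_cont _ _; split.
  have I0 : I w = 0.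
    have limI : (fun n => B (pi_ n)`_0 w) @ \oo --> I w.
      by move: RSw; under eq_fun do rewrite sumE.
    rewrite -B0; exact: (cvg_unique (@Rhausdorff R) limI lim0).
  have <- : M T w = 0 by rewrite MIw B0 I0 addr0.
  by apply: le_running_max cB _ _; rewrite ?lexx ?ltW.
have BT1 : (B T : Omega -> R) \in Lfun P 1%E.
  exact: (Lfun_subset12 (fin_num_measure P _ measurableT) (fbm_Lfun2 BH TT)).
(* A nonpositive centered B_T would have second moment 0, whereas the covariance formula gives
   T^(2H) > 0. *)
have := ae_le0_expectation0 BT1 BT_le0 (fbm_centered BH TT).
rewrite (fbm_covariance BH)// subrr normr0 powR0; last first.
  by move: H01 => /andP[H0 _]; rewrite mulf_neq0// gt_eqF.
by move=> -[] /eqP; rewrite subr0 gt_eqF// mulr_gt0 ?invr_gt0// addr_gt0 ?powR_gt0.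
Qed.
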